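(* Let $\gamma>0$, $p>0$, $p_2\ge p$, $b>0$, $q_{\max}>b+p/\gamma$, and let $p_r\in[0,1]$ be the probability of call. For given reports $(\hat b,\hat q)$ and $r\in\{0,1\}$, let $q_r^*=q_r^*(\hat b,\hat q)$ be the optimal second-stage consumption, $$q_r^*=\arg\max_{q\in[0,q_{\max}]}\; G(q;b)-\pi_3^{r}(q;\hat b,\hat q).$$ Given $q_0^*$ and $q_1^*$, consider the first-stage (reporting) problem $$[\hat b^*,\hat q^*]=\arg\max_{\hat b,\hat q\in[0,q_{\max}],\ \hat q\le\hat b}\; p_r\big[G(q_1^*;b)-\pi_3^{1}(q_1^*;\hat b,\hat q)\big]+(1-p_r)\big[G(q_0^*;b)-\pi_3^{0}(q_0^*;\hat b,\hat q)\big].$$ Then the optimal reports $\hat b^*$ and $\hat q^*$ are $$\hat b^*=\begin{cases} \dfrac{p_r\,p_2}{\gamma(1-p_r)}+b & 0\le p_r\le \dfrac{p}{p_2+p},\\[2mm] q_{\max} & \dfrac{p}{p_2+p}\le p_r\le 1,\end{cases}\qquad \hat q^*=\Big(b-\frac{p_2}{\gamma}\Big)_+ .$$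
   Context: Notation: $(x)_+=\max(x,0)$. All quantities are real numbers for a single consumer: $b$ is the true baseline, $\gamma$ the marginal-utility parameter, $p$ the energy price, $p_2$ the incentive/penalty price, $q_{\max}$ the maximum allowable consumption, $\hat b$ the reported baseline, $\hat q$ the reported reduced consumption under demand response, $q$ the actual consumption, and $r\in\{0,1\}$ indicates whether the consumer is called ($r=1$) or not ($r=0$), with $\Pr(r=1)=p_r$. The consumer first reports $(\hat b,\hat q)$, then learns $r$, then chooses $q$. The contract requires $\hat b\ge\hat q$. Utility function: $$G(q;b)=\begin{cases}-\frac{\gamma}{2}q^2+(\gamma b+p)q & 0\le q\le b+\frac{p}{\gamma},\\ \frac{p^2}{2\gamma}+\frac{\gamma b^2}{2}+pb & q>b+\frac{p}{\gamma}.\end{cases}$$ Payment scheme of the contract: $$\pi_3^{r}(q;\hat b,\hat q)=\begin{cases}p\max(\hat b,q) & r=0,\\ pq-p_2(\hat b-q)_+ +p_2|q-\hat q| & r=1.\end{cases}$$ *)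

(* Defs.v *)
From Stdlib Require Import Reals.
Open Scope R_scope.

Definition pos_part (x : R) : R := Rmax x 0.

Definition is_argmax {T : Type} (D : T -> Prop) (f : T -> R) (x : T) : Prop :=
  D x /\ forall y : T, D y -> f y <= f x.

(* Total in q; only its values on 0 <= q are meaningful. *)
Definition G (gamma p b q : R) : R :=
  if Rle_dec q (b + p / gamma)
  then - (gamma / 2) * q ^ 2 + (gamma * b + p) * q
  else p ^ 2 / (2 * gamma) + gamma * b ^ 2 / 2 + p * b.

(* r = true: the consumer is called; r = false: not called. *)
Definition pi3 (p p2 : R) (r : bool) (q bhat qhat : R) : R :=
  if r
  then p * q - p2 * pos_part (bhat - q) + p2 * Rabs (q - qhat)
  else p * Rmax bhat q.

Definition profit (gamma p p2 b : R) (r : bool) (bhat qhat q : R) : R :=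
  G gamma p b q - pi3 p p2 r q bhat qhat.

Definition feasible_consumption (qmax q : R) : Prop := 0 <= q <= qmax.

(* Reports are pairs (bhat, qhat). *)
Definition feasible_report (qmax : R) (x : R * R) : Prop :=
  0 <= fst x <= qmax /\ 0 <= snd x <= qmax /\ snd x <= fst x.

(* The second-stage maximizer need not be unique, so qstar is an arbitrary
   selection of maximizers, one for each feasible report. *)
Definition optimal_consumption (gamma p p2 b qmax : R)
    (qstar : bool -> R -> R -> R) : Prop :=
  forall (r : bool) (bhat qhat : R),
    feasible_report qmax (bhat, qhat) ->
    is_argmax (feasible_consumption qmax)
      (profit gamma p p2 b r bhat qhat) (qstar r bhat qhat).

Definition expected_profit (gamma p p2 b pr : R) (qstar : bool -> R -> R -> R)
    (x : R * R) : R :=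
  let (bhat, qhat) := x in
  pr * profit gamma p p2 b true bhat qhat (qstar true bhat qhat)
  + (1 - pr) * profit gamma p p2 b false bhat qhat (qstar false bhat qhat).

Definition optimal_report (gamma p p2 b qmax pr : R)
    (qstar : bool -> R -> R -> R) (bhat qhat : R) : Prop :=
  is_argmax (feasible_report qmax) (expected_profit gamma p p2 b pr qstar)
    (bhat, qhat).

(* Main.v *)
Require Import Defs.
From Stdlib Require Import Reals.
From Stdlib Require Import Lra.
Open Scope R_scope.

(** The net utility [U q = G q - p q] is concave and peaks at [q = b].  When the
    consumer is not called, the best consumption is [Rmax bhat b], with value
    [U (Rmax bhat b)].  When called, the value is at most
    [p2 bhat + max_q (U q - p2 q)], where the maximum is reached only at
    [Q = pos_part (b - p2 / gamma)]; the bound is attained for [qhat = Q], and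
    for [b <= bhat] only then.  It remains to maximize
    [pr p2 bhat + (1 - pr) U (Rmax bhat b)] over [bhat]: this is done by comparing
    [U] with its tangent of slope [- pr p2 / (1 - pr)] as long as this slope is at
    least [- p], the smallest slope of [U], and otherwise the maximum is at the
    right end point. *)

Lemma argmax_value {T : Type} (D : T -> Prop) (f : T -> R) (x y : T) :
  is_argmax D f x -> is_argmax D f y -> f x = f y.
Proof. intros [Dx Hx] [Dy Hy]; apply Rle_antisym; auto. Qed.

(** * Monotonicity of the utility and tangent bounds for the net utility *)

Lemma G_low (gamma p b q : R) :
  q <= b + p / gamma ->
  G gamma p b q = - (gamma / 2) * q ^ 2 + (gamma * b + p) * q.
Proof. intros Hq; unfold G; destruct (Rle_dec q (b + p / gamma)); lra. Qed.

Lemma G_high (gamma p b q : R) :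
  0 < gamma -> b + p / gamma <= q ->
  G gamma p b q = gamma / 2 * (b + p / gamma) ^ 2.
Proof.
intros Hg Hq; unfold G; destruct (Rle_dec q (b + p / gamma)) as [Hle|Hgt].
- replace q with (b + p / gamma) by lra; field; lra.
- field; lra.
Qed.

(** With [c = b + p / gamma] the vertex of the parabola, the increment on that branch is
    [gamma / 2 * (y - x) * (2 * c - x - y)]; past [c] the utility stays at its maximum. *)
Lemma G_nondecreasing (gamma p b x y : R) :
  0 < gamma -> x <= y -> G gamma p b x <= G gamma p b y.
Proof.
intros Hg Hxy.
assert (Hc : gamma * (b + p / gamma) = gamma * b + p) by (field; lra).
destruct (Rle_dec y (b + p / gamma)) as [Hy|Hy].
- rewrite !G_low by lra.
  rewrite <- Hc.
  assert (0 <= gamma * ((y - x) * (2 * (b + p / gamma) - x - y))).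
  { apply Rmult_le_pos; [lra|apply Rmult_le_pos; lra]. }
  lra.
- rewrite (G_high gamma p b y) by lra.
  destruct (Rle_dec x (b + p / gamma)) as [Hx|Hx].
  + rewrite G_low by lra; rewrite <- Hc.
    assert (0 <= gamma * (b + p / gamma - x) ^ 2).
    { apply Rmult_le_pos; [lra|apply pow2_ge_0]. }
    lra.
  + rewrite G_high by lra; lra.
Qed.

Definition net_utility (gamma p b q : R) : R := G gamma p b q - p * q.

(** The gap below the tangent at [y] is [gamma / 2 * (q - y) ^ 2] up to the vertex [c], and
    [gamma / 2 * (c - y) * (2 * q - y - c)] past it. *)
Lemma net_utility_tangent_lt (gamma p b y q : R) :
  0 < gamma -> y < b + p / gamma -> q <> y ->
  net_utility gamma p b q
    < net_utility gamma p b y + gamma * (b - y) * (q - y).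
Proof.
intros Hg Hy Hq; unfold net_utility.
set (c := b + p / gamma) in *.
assert (Hc : gamma * c = gamma * b + p) by (unfold c; field; lra).
rewrite (G_low gamma p b y) by (fold c; lra).
destruct (Rle_dec q c) as [Hqc|Hqc].
- rewrite G_low by (fold c; lra).
  assert (0 < gamma * (q - y) ^ 2).
  { apply Rmult_lt_0_compat; [lra|rewrite <- Rsqr_pow2; apply Rsqr_pos_lt; lra]. }
  lra.
- rewrite G_high by (fold c; lra).
  fold c.
  replace p with (gamma * c - gamma * b) by lra.
  assert (0 < gamma * ((c - y) * (2 * q - y - c))).
  { apply Rmult_lt_0_compat; [lra|apply Rmult_lt_0_compat; lra]. }
  lra.
Qed.

Lemma net_utility_tangent_le (gamma p b y q : R) :
  0 < gamma -> y <= b + p / gamma ->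
  net_utility gamma p b q
    <= net_utility gamma p b y + gamma * (b - y) * (q - y).
Proof.
intros Hg [Hy|Hy].
- destruct (Req_dec q y) as [->|Hq]; [lra|].
  apply Rlt_le, net_utility_tangent_lt; lra.
(* At the vertex the tangent has slope [- p] and coincides with the net utility to its right, so
   strictness is lost; the bound amounts to [G q <= G y]. *)
- assert (Hslope : gamma * (b - y) = - p) by (rewrite Hy; field; lra).
  rewrite Hslope; unfold net_utility.
  destruct (Rle_dec q y) as [Hq|Hq].
  + assert (G gamma p b q <= G gamma p b y) by (apply G_nondecreasing; lra).
    lra.
  + rewrite !G_high by lra; lra.
Qed.

Lemma net_utility_decreasing (gamma p b x y : R) :
  0 < gamma -> 0 < p -> b <= x -> x <= y ->
  net_utility gamma p b y <= net_utility gamma p b x.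
Proof.
intros Hg Hp Hbx Hxy.
destruct (Rle_dec x (b + p / gamma)) as [Hx|Hx].
- pose proof (net_utility_tangent_le gamma p b x y Hg Hx) as Ht.
  assert (0 <= gamma * (x - b) * (y - x)).
  { apply Rmult_le_pos; [apply Rmult_le_pos|]; lra. }
  lra.
- unfold net_utility; rewrite !G_high by lra; nra.
Qed.

Lemma net_utility_lower_slope (gamma p b x y : R) :
  0 < gamma -> x <= y ->
  net_utility gamma p b x - p * (y - x) <= net_utility gamma p b y.
Proof.
intros Hg Hxy; unfold net_utility.
pose proof (G_nondecreasing gamma p b x y Hg Hxy); lra.
Qed.

(** * Second stage when the consumer is not called *)

Lemma argmax_uncalled (gamma p p2 b qmax bhat qhat : R) :
  0 < gamma -> 0 < p -> 0 < b -> b <= qmax -> 0 <= bhat <= qmax ->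
  is_argmax (feasible_consumption qmax)
    (profit gamma p p2 b false bhat qhat) (Rmax bhat b).
Proof.
intros Hg Hp Hb Hbq Hbhat.
assert (Hpg : 0 < p / gamma) by (apply Rdiv_lt_0_compat; lra).
split.
- unfold feasible_consumption, Rmax; destruct (Rle_dec bhat b); lra.
- intros q Hq; unfold profit, pi3.
  rewrite (Rmax_right bhat (Rmax bhat b)) by apply Rmax_l.
  (* Consumption up to [bhat] is already paid for, so raising [q] to [Rmax bhat q] leaves the
     payment unchanged. *)
  assert (HG : G gamma p b q <= G gamma p b (Rmax bhat q)).
  { apply G_nondecreasing; [lra|apply Rmax_r]. }
  assert (HU : net_utility gamma p b (Rmax bhat q)
                 <= net_utility gamma p b (Rmax bhat b)).
  { destruct (Rle_dec bhat b) as [Hle|Hgt].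
    - rewrite (Rmax_right bhat b) by lra.
      (* The tangent at [b] is horizontal. *)
      pose proof (net_utility_tangent_le gamma p b b (Rmax bhat q) Hg); lra.
    - rewrite (Rmax_left bhat b) by lra.
      apply net_utility_decreasing; try lra; apply Rmax_l. }
  unfold net_utility in HU; lra.
Qed.

Lemma profit_uncalled (gamma p p2 b bhat qhat : R) :
  profit gamma p p2 b false bhat qhat (Rmax bhat b)
    = net_utility gamma p b (Rmax bhat b).
Proof.
unfold profit, pi3, net_utility.
rewrite (Rmax_right bhat (Rmax bhat b)) by apply Rmax_l; reflexivity.
Qed.

(** * Second stage when the consumer is called *)

Lemma pos_part_bounds (gamma p2 b : R) :
  0 < gamma -> 0 < p2 -> 0 < b ->
  0 <= pos_part (b - p2 / gamma) < b.
Proof.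
intros Hg Hp2 Hb.
assert (0 < p2 / gamma) by (apply Rdiv_lt_0_compat; lra).
unfold pos_part, Rmax; destruct (Rle_dec (b - p2 / gamma) 0); lra.
Qed.

(** Take the tangent of the net utility at the claimed maximizer. If the maximizer is positive, the
    slope there is exactly [p2]; if it is 0, the slope is [gamma * b <= p2], and [0 <= q] gives the
    sign. *)
Lemma penalized_utility_lt (gamma p p2 b q : R) :
  0 < gamma -> 0 < p -> 0 < p2 -> 0 < b -> 0 <= q ->
  q <> pos_part (b - p2 / gamma) ->
  net_utility gamma p b q - p2 * q
    < net_utility gamma p b (pos_part (b - p2 / gamma))
      - p2 * pos_part (b - p2 / gamma).
Proof.
intros Hg Hp Hp2 Hb Hq Hne.
pose proof (pos_part_bounds gamma p2 b Hg Hp2 Hb) as HQ.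
assert (Hpg : 0 < p / gamma) by (apply Rdiv_lt_0_compat; lra).
assert (Hp2g : gamma * (p2 / gamma) = p2) by (field; lra).
pose proof (net_utility_tangent_lt gamma p b (pos_part (b - p2 / gamma)) q
  Hg ltac:(lra) Hne) as Ht.
revert Hne HQ Ht; unfold pos_part, Rmax.
destruct (Rle_dec (b - p2 / gamma) 0); intros Hne HQ Ht.
- assert (0 <= gamma * (p2 / gamma - b) * q).
  { apply Rmult_le_pos; [apply Rmult_le_pos|]; lra. }
  replace p2 with (gamma * (p2 / gamma)) by exact Hp2g.
  lra.
- replace (gamma * (b - (b - p2 / gamma))) with p2 in Ht by lra.
  lra.
Qed.

Lemma penalized_utility_le (gamma p p2 b q : R) :
  0 < gamma -> 0 < p -> 0 < p2 -> 0 < b -> 0 <= q ->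
  net_utility gamma p b q - p2 * q
    <= net_utility gamma p b (pos_part (b - p2 / gamma))
      - p2 * pos_part (b - p2 / gamma).
Proof.
intros Hg Hp Hp2 Hb Hq.
destruct (Req_dec q (pos_part (b - p2 / gamma))) as [->|Hne]; [lra|].
now apply Rlt_le, penalized_utility_lt.
Qed.

(** For [q <= bhat] the absolute value only subtracts; for [q > bhat] the reward vanishes and the
    penalty [q - qhat] is at least [q - bhat]. This is where the contract's constraint on reports
    enters. *)
Lemma incentive_le (bhat qhat q : R) :
  qhat <= bhat -> pos_part (bhat - q) - Rabs (q - qhat) <= bhat - q.
Proof.
intros H; unfold pos_part, Rmax, Rabs.
destruct (Rle_dec (bhat - q) 0), (Rcase_abs (q - qhat)); lra.
Qed.

(** Past [bhat], equality also occurs when [qhat = bhat], hence the condition [q < bhat]. *)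
Lemma incentive_lt (bhat qhat q : R) :
  qhat <= bhat -> q < bhat -> q <> qhat ->
  pos_part (bhat - q) - Rabs (q - qhat) < bhat - q.
Proof.
intros H Hq Hne; unfold pos_part, Rmax, Rabs.
destruct (Rle_dec (bhat - q) 0), (Rcase_abs (q - qhat)); lra.
Qed.

Lemma profit_called_eq (gamma p p2 b bhat qhat q : R) :
  profit gamma p p2 b true bhat qhat q
    = net_utility gamma p b q + p2 * (pos_part (bhat - q) - Rabs (q - qhat)).
Proof. unfold profit, pi3, net_utility; ring. Qed.

Lemma profit_called_le (gamma p p2 b bhat qhat q : R) :
  0 < gamma -> 0 < p -> 0 < p2 -> 0 < b -> 0 <= q -> qhat <= bhat ->
  profit gamma p p2 b true bhat qhat q
    <= net_utility gamma p b (pos_part (b - p2 / gamma))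
       + p2 * (bhat - pos_part (b - p2 / gamma)).
Proof.
intros Hg Hp Hp2 Hb Hq Hr; rewrite profit_called_eq.
pose proof (penalized_utility_le gamma p p2 b q Hg Hp Hp2 Hb Hq).
pose proof (Rmult_le_compat_l p2 _ _ (Rlt_le _ _ Hp2)
  (incentive_le bhat qhat q Hr)).
lra.
Qed.

(** Either [q] misses the maximizer of the penalized utility, or it equals it; in the latter case
    [q < b <= bhat] and [q] differs from [qhat], so the incentive is strictly smaller. *)
Lemma profit_called_lt (gamma p p2 b bhat qhat q : R) :
  0 < gamma -> 0 < p -> 0 < p2 -> 0 < b -> 0 <= q -> qhat <= bhat ->
  b <= bhat -> qhat <> pos_part (b - p2 / gamma) ->
  profit gamma p p2 b true bhat qhat q
    < net_utility gamma p b (pos_part (b - p2 / gamma))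
      + p2 * (bhat - pos_part (b - p2 / gamma)).
Proof.
intros Hg Hp Hp2 Hb Hq Hr Hbb Hne; rewrite profit_called_eq.
pose proof (pos_part_bounds gamma p2 b Hg Hp2 Hb) as HQ.
destruct (Req_dec q (pos_part (b - p2 / gamma))) as [->|Hqne].
- pose proof (Rmult_lt_compat_l p2 _ _ Hp2
    (incentive_lt bhat qhat (pos_part (b - p2 / gamma)) Hr
       ltac:(lra) ltac:(lra))).
  lra.
- pose proof (penalized_utility_lt gamma p p2 b q Hg Hp Hp2 Hb Hq Hqne).
  pose proof (Rmult_le_compat_l p2 _ _ (Rlt_le _ _ Hp2)
    (incentive_le bhat qhat q Hr)).
  lra.
Qed.

Lemma profit_called_attained (gamma p p2 b bhat : R) :
  0 < gamma -> 0 < p2 -> 0 < b -> b <= bhat ->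
  profit gamma p p2 b true bhat (pos_part (b - p2 / gamma))
      (pos_part (b - p2 / gamma))
    = net_utility gamma p b (pos_part (b - p2 / gamma))
      + p2 * (bhat - pos_part (b - p2 / gamma)).
Proof.
intros Hg Hp2 Hb Hbb; rewrite profit_called_eq.
pose proof (pos_part_bounds gamma p2 b Hg Hp2 Hb) as HQ.
rewrite Rminus_diag, Rabs_R0.
unfold pos_part at 2; rewrite Rmax_left by lra; ring.
Qed.

(** * First stage: maximizing over the reported baseline *)

(* The part of the expected profit depending on [bhat] once [qhat] is optimal. *)
Definition report_gain (gamma p p2 b pr bhat : R) : R :=
  pr * p2 * bhat + (1 - pr) * net_utility gamma p b (Rmax bhat b).

Lemma report_gain_lt_baseline (gamma p p2 b pr bhat : R) :
  0 < pr -> 0 < p2 -> bhat < b ->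
  report_gain gamma p p2 b pr bhat < report_gain gamma p p2 b pr b.
Proof.
intros Hpr Hp2 Hb; unfold report_gain.
rewrite !Rmax_right by lra.
assert (0 < pr * p2) by (apply Rmult_lt_0_compat; lra).
nra.
Qed.

(** At the threshold [p / (p2 + p)] the marginal reward [pr * p2] equals [(1 - pr) * p], the
    steepest expected marginal loss of net utility. *)
Lemma low_probability_bounds (p p2 pr : R) :
  0 < p -> 0 < p2 -> 0 <= pr -> pr <= p / (p2 + p) ->
  pr < 1 /\ pr * p2 <= (1 - pr) * p.
Proof.
intros Hp Hp2 Hpr H.
assert (Hm : pr * (p2 + p) <= p).
{ apply (Rmult_le_compat_r (p2 + p)) in H; [|lra].
  replace (p / (p2 + p) * (p2 + p)) with p in H by (field; lra); exact H. }
split; nra.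
Qed.

Lemma strict_low_probability (p p2 pr : R) :
  0 < p -> 0 < p2 -> pr < p / (p2 + p) -> pr * p2 < (1 - pr) * p.
Proof.
intros Hp Hp2 H.
apply (Rmult_lt_compat_r (p2 + p)) in H; [|lra].
replace (p / (p2 + p) * (p2 + p)) with p in H by (field; lra); lra.
Qed.

Lemma high_probability (p p2 pr : R) :
  0 < p -> 0 < p2 -> p / (p2 + p) <= pr -> (1 - pr) * p <= pr * p2.
Proof.
intros Hp Hp2 H.
apply (Rmult_le_compat_r (p2 + p)) in H; [|lra].
replace (p / (p2 + p) * (p2 + p)) with p in H by (field; lra); lra.
Qed.

Lemma strict_high_probability (p p2 pr : R) :
  0 < p -> 0 < p2 -> p / (p2 + p) < pr -> (1 - pr) * p < pr * p2.
Proof.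
intros Hp Hp2 H.
apply (Rmult_lt_compat_r (p2 + p)) in H; [|lra].
replace (p / (p2 + p) * (p2 + p)) with p in H by (field; lra); lra.
Qed.

(** Places the candidate report between the peak of the net utility and the vertex of the parabola,
    where the tangent bound applies. *)
Lemma low_report_bounds (gamma p p2 b pr : R) :
  0 < gamma -> 0 < p2 -> 0 <= pr < 1 -> pr * p2 <= (1 - pr) * p ->
  b <= pr * p2 / (gamma * (1 - pr)) + b <= b + p / gamma.
Proof.
intros Hg Hp2 Hpr H.
assert (Hd : 0 < gamma * (1 - pr)) by (apply Rmult_lt_0_compat; lra).
assert (Hi : 0 < / (gamma * (1 - pr))) by (apply Rinv_0_lt_compat; lra).
replace (p / gamma) with ((1 - pr) * p / (gamma * (1 - pr))) by (field; lra).
unfold Rdiv.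
pose proof (Rmult_le_compat_r _ _ _ (Rlt_le _ _ Hi) H).
assert (0 <= pr * p2 * / (gamma * (1 - pr))).
{ apply Rmult_le_pos; [apply Rmult_le_pos|]; lra. }
lra.
Qed.

Lemma strict_low_report_bound (gamma p p2 b pr : R) :
  0 < gamma -> pr < 1 -> pr * p2 < (1 - pr) * p ->
  pr * p2 / (gamma * (1 - pr)) + b < b + p / gamma.
Proof.
intros Hg Hpr H.
assert (Hd : 0 < gamma * (1 - pr)) by (apply Rmult_lt_0_compat; lra).
assert (Hi : 0 < / (gamma * (1 - pr))) by (apply Rinv_0_lt_compat; lra).
replace (p / gamma) with ((1 - pr) * p / (gamma * (1 - pr))) by (field; lra).
unfold Rdiv.
pose proof (Rmult_lt_compat_r _ _ _ Hi H).
lra.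
Qed.

Lemma report_gain_low_le (gamma p p2 b pr bhat : R) :
  0 < gamma -> 0 < p2 -> 0 <= pr < 1 -> pr * p2 <= (1 - pr) * p ->
  report_gain gamma p p2 b pr bhat
    <= report_gain gamma p p2 b pr (pr * p2 / (gamma * (1 - pr)) + b).
Proof.
intros Hg Hp2 Hpr H.
pose proof (low_report_bounds gamma p p2 b pr Hg Hp2 Hpr H) as Hy.
(* First-order condition defining the candidate: the expected slope of the net utility cancels the
   marginal reward. *)
assert (Hs : (1 - pr) * (gamma * (b - (pr * p2 / (gamma * (1 - pr)) + b)))
               = - (pr * p2)) by (field; lra).
set (y := pr * p2 / (gamma * (1 - pr)) + b) in *.
unfold report_gain; rewrite (Rmax_left y b) by lra.
pose proof (net_utility_tangent_le gamma p b y (Rmax bhat b) Hg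
  ltac:(lra)) as Ht.
apply (Rmult_le_compat_l (1 - pr)) in Ht; [|lra].
assert (0 <= pr * p2 * (Rmax bhat b - bhat)).
{ pose proof (Rmax_l bhat b).
  apply Rmult_le_pos; [apply Rmult_le_pos|]; lra. }
replace ((1 - pr) * (net_utility gamma p b y
             + gamma * (b - y) * (Rmax bhat b - y)))
  with ((1 - pr) * net_utility gamma p b y
        + (1 - pr) * (gamma * (b - y)) * (Rmax bhat b - y)) in Ht by ring.
rewrite Hs in Ht; lra.
Qed.

(** The strict inequality on [pr] puts the candidate strictly before the vertex, where the tangent
    touches only once. *)
Lemma report_gain_low_lt (gamma p p2 b pr bhat : R) :
  0 < gamma -> 0 < p2 -> 0 < pr < 1 -> pr * p2 < (1 - pr) * p ->
  bhat <> pr * p2 / (gamma * (1 - pr)) + b ->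
  report_gain gamma p p2 b pr bhat
    < report_gain gamma p p2 b pr (pr * p2 / (gamma * (1 - pr)) + b).
Proof.
intros Hg Hp2 Hpr H Hne.
destruct (Rlt_le_dec bhat b) as [Hb|Hb].
- apply Rlt_le_trans with (report_gain gamma p p2 b pr b).
  + apply report_gain_lt_baseline; lra.
  + apply report_gain_low_le; lra.
- pose proof (low_report_bounds gamma p p2 b pr Hg Hp2 ltac:(lra)
    ltac:(lra)) as Hy.
  pose proof (strict_low_report_bound gamma p p2 b pr Hg ltac:(lra) H) as Hy'.
  assert (Hs : (1 - pr) * (gamma * (b - (pr * p2 / (gamma * (1 - pr)) + b)))
                 = - (pr * p2)) by (field; lra).
  set (y := pr * p2 / (gamma * (1 - pr)) + b) in *.
  unfold report_gain; rewrite !Rmax_left by lra.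
  pose proof (net_utility_tangent_lt gamma p b y bhat Hg Hy' Hne) as Ht.
  apply (Rmult_lt_compat_l (1 - pr)) in Ht; [|lra].
  replace ((1 - pr) * (net_utility gamma p b y
               + gamma * (b - y) * (bhat - y)))
    with ((1 - pr) * net_utility gamma p b y
          + (1 - pr) * (gamma * (b - y)) * (bhat - y)) in Ht by ring.
  rewrite Hs in Ht; lra.
Qed.

(** Each unit added to the report loses at most [(1 - pr) * p] in expected net utility, which the
    reward [pr * p2] covers. *)
Lemma report_gain_high_le (gamma p p2 b qmax pr bhat : R) :
  0 < gamma -> 0 < p2 -> 0 <= pr <= 1 -> b <= qmax -> bhat <= qmax ->
  (1 - pr) * p <= pr * p2 ->
  report_gain gamma p p2 b pr bhat <= report_gain gamma p p2 b pr qmax.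
Proof.
intros Hg Hp2 Hpr Hbq Hq H; unfold report_gain.
rewrite (Rmax_left qmax b) by lra.
assert (Hm : Rmax bhat b <= qmax) by (apply Rmax_lub; lra).
pose proof (Rmax_l bhat b) as Hl.
pose proof (net_utility_lower_slope gamma p b _ _ Hg Hm) as Hs.
apply (Rmult_le_compat_l (1 - pr)) in Hs; [|lra].
pose proof (Rmult_le_compat_r (qmax - Rmax bhat b) _ _ ltac:(lra) H).
assert (0 <= pr * p2 * (Rmax bhat b - bhat)).
{ apply Rmult_le_pos; [apply Rmult_le_pos|]; lra. }
lra.
Qed.

Lemma report_gain_high_lt (gamma p p2 b qmax pr bhat : R) :
  0 < gamma -> 0 < p2 -> 0 < pr <= 1 -> b <= qmax -> bhat < qmax ->
  (1 - pr) * p < pr * p2 ->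
  report_gain gamma p p2 b pr bhat < report_gain gamma p p2 b pr qmax.
Proof.
intros Hg Hp2 Hpr Hbq Hq H.
destruct (Rlt_le_dec bhat b) as [Hb|Hb].
- apply Rlt_le_trans with (report_gain gamma p p2 b pr b).
  + apply report_gain_lt_baseline; lra.
  + apply report_gain_high_le; lra.
- unfold report_gain; rewrite !Rmax_left by lra.
  pose proof (net_utility_lower_slope gamma p b bhat qmax Hg ltac:(lra)) as Hs.
  apply (Rmult_le_compat_l (1 - pr)) in Hs; [|lra].
  pose proof (Rmult_lt_compat_r (qmax - bhat) _ _ ltac:(lra) H).
  lra.
Qed.

(** * Combining the two stages into bounds on the expected profit *)

Definition called_constant (gamma p p2 b pr : R) : R :=
  pr * (net_utility gamma p b (pos_part (b - p2 / gamma))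
        - p2 * pos_part (b - p2 / gamma)).

Lemma uncalled_value (gamma p p2 b qmax bhat qhat : R)
    (qstar : bool -> R -> R -> R) :
  0 < gamma -> 0 < p -> 0 < b -> b <= qmax ->
  optimal_consumption gamma p p2 b qmax qstar ->
  feasible_report qmax (bhat, qhat) ->
  profit gamma p p2 b false bhat qhat (qstar false bhat qhat)
    = net_utility gamma p b (Rmax bhat b).
Proof.
intros Hg Hp Hb Hbq Hopt Hf.
rewrite <- (profit_uncalled gamma p p2 b bhat qhat).
(* The selected consumption may differ from [Rmax bhat b], but all maximizers share one value. *)
apply (argmax_value (feasible_consumption qmax)).
- apply Hopt, Hf.
- destruct Hf as [Hf _]; cbn in Hf; apply argmax_uncalled; lra.
Qed.

Lemma expected_profit_le (gamma p p2 b qmax pr bhat qhat : R)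
    (qstar : bool -> R -> R -> R) :
  0 < gamma -> 0 < p -> 0 < p2 -> 0 < b -> b <= qmax -> 0 <= pr ->
  optimal_consumption gamma p p2 b qmax qstar ->
  feasible_report qmax (bhat, qhat) ->
  expected_profit gamma p p2 b pr qstar (bhat, qhat)
    <= called_constant gamma p p2 b pr + report_gain gamma p p2 b pr bhat.
Proof.
intros Hg Hp Hp2 Hb Hbq Hpr Hopt Hf; unfold expected_profit.
rewrite (uncalled_value gamma p p2 b qmax) by assumption.
destruct (Hopt true bhat qhat Hf) as [[Hq _] _].
destruct Hf as [_ [_ Hr]]; cbn in Hr.
pose proof (Rmult_le_compat_l pr _ _ Hpr
  (profit_called_le gamma p p2 b bhat qhat _ Hg Hp Hp2 Hb Hq Hr)).
unfold called_constant, report_gain; lra.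
Qed.

Lemma expected_profit_lt (gamma p p2 b qmax pr bhat qhat : R)
    (qstar : bool -> R -> R -> R) :
  0 < gamma -> 0 < p -> 0 < p2 -> 0 < b -> b <= qmax -> 0 < pr ->
  optimal_consumption gamma p p2 b qmax qstar ->
  feasible_report qmax (bhat, qhat) ->
  b <= bhat -> qhat <> pos_part (b - p2 / gamma) ->
  expected_profit gamma p p2 b pr qstar (bhat, qhat)
    < called_constant gamma p p2 b pr + report_gain gamma p p2 b pr bhat.
Proof.
intros Hg Hp Hp2 Hb Hbq Hpr Hopt Hf Hbb Hne; unfold expected_profit.
rewrite (uncalled_value gamma p p2 b qmax) by assumption.
destruct (Hopt true bhat qhat Hf) as [[Hq _] _].
destruct Hf as [_ [_ Hr]]; cbn in Hr.
pose proof (Rmult_lt_compat_l pr _ _ Hpr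
  (profit_called_lt gamma p p2 b bhat qhat _ Hg Hp Hp2 Hb Hq Hr Hbb Hne)).
unfold called_constant, report_gain; lra.
Qed.

Lemma feasible_reduced_report (gamma p2 b qmax bhat : R) :
  0 < gamma -> 0 < p2 -> 0 < b -> b <= bhat <= qmax ->
  feasible_report qmax (bhat, pos_part (b - p2 / gamma)).
Proof.
intros Hg Hp2 Hb Hbb.
pose proof (pos_part_bounds gamma p2 b Hg Hp2 Hb).
unfold feasible_report; cbn; lra.
Qed.

Lemma expected_profit_attained (gamma p p2 b qmax pr bhat : R)
    (qstar : bool -> R -> R -> R) :
  0 < gamma -> 0 < p -> 0 < p2 -> 0 < b -> b <= qmax -> 0 <= pr ->
  optimal_consumption gamma p p2 b qmax qstar ->
  b <= bhat <= qmax ->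
  called_constant gamma p p2 b pr + report_gain gamma p p2 b pr bhat
    <= expected_profit gamma p p2 b pr qstar
         (bhat, pos_part (b - p2 / gamma)).
Proof.
intros Hg Hp Hp2 Hb Hbq Hpr Hopt Hbb; unfold expected_profit.
pose proof (feasible_reduced_report gamma p2 b qmax bhat Hg Hp2 Hb Hbb) as Hf.
rewrite (uncalled_value gamma p p2 b qmax) by assumption.
pose proof (pos_part_bounds gamma p2 b Hg Hp2 Hb) as HQ.
destruct (Hopt true _ _ Hf) as [_ Hmax].
(* The selected consumption does at least as well as consuming the reported [qhat] itself. *)
specialize (Hmax (pos_part (b - p2 / gamma))).
rewrite profit_called_attained in Hmax by lra.
pose proof (Rmult_le_compat_l pr _ _ Hpr
  (Hmax ltac:(unfold feasible_consumption; lra))).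
unfold called_constant, report_gain; lra.
Qed.

(** Reduces optimality of the pair of reports to a one-variable maximization. *)
Lemma optimal_report_of_gain (gamma p p2 b qmax pr bhat : R)
    (qstar : bool -> R -> R -> R) :
  0 < gamma -> 0 < p -> 0 < p2 -> 0 < b -> b <= qmax -> 0 <= pr ->
  optimal_consumption gamma p p2 b qmax qstar ->
  b <= bhat <= qmax ->
  (forall x, x <= qmax ->
     report_gain gamma p p2 b pr x <= report_gain gamma p p2 b pr bhat) ->
  optimal_report gamma p p2 b qmax pr qstar bhat (pos_part (b - p2 / gamma)).
Proof.
intros Hg Hp Hp2 Hb Hbq Hpr Hopt Hbb Hgain; split.
- now apply feasible_reduced_report.
- intros [x y] Hxy.
  pose proof (expected_profit_le gamma p p2 b qmax pr x y qstar
    Hg Hp Hp2 Hb Hbq Hpr Hopt Hxy).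
  pose proof (expected_profit_attained gamma p p2 b qmax pr bhat qstar
    Hg Hp Hp2 Hb Hbq Hpr Hopt Hbb).
  destruct Hxy as [Hx _]; cbn in Hx.
  specialize (Hgain x ltac:(lra)); lra.
Qed.

Lemma gain_of_optimal_report (gamma p p2 b qmax pr bhat qhat x : R)
    (qstar : bool -> R -> R -> R) :
  0 < gamma -> 0 < p -> 0 < p2 -> 0 < b -> b <= qmax -> 0 <= pr ->
  optimal_consumption gamma p p2 b qmax qstar ->
  optimal_report gamma p p2 b qmax pr qstar bhat qhat ->
  b <= x <= qmax ->
  report_gain gamma p p2 b pr x <= report_gain gamma p p2 b pr bhat.
Proof.
intros Hg Hp Hp2 Hb Hbq Hpr Hopt [Hf Hmax] Hx.
pose proof (Hmax _ (feasible_reduced_report gamma p2 b qmax x Hg Hp2 Hb Hx)).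
pose proof (expected_profit_le gamma p p2 b qmax pr bhat qhat qstar
  Hg Hp Hp2 Hb Hbq Hpr Hopt Hf).
pose proof (expected_profit_attained gamma p p2 b qmax pr x qstar
  Hg Hp Hp2 Hb Hbq Hpr Hopt Hx).
lra.
Qed.

(** Uniqueness is stated for [0 < pr], since at [pr = 0] the called profit has no weight, and for
    [pr] off the threshold, where every baseline report from [b + p / gamma] to [qmax] has the same
    gain. *)
Theorem theorem3 (gamma p p2 b qmax pr : R) (qstar : bool -> R -> R -> R)
    (hgamma : 0 < gamma) (hp : 0 < p) (hp2 : p <= p2) (hb : 0 < b)
    (hqmax : b + p / gamma < qmax) (hpr : 0 <= pr <= 1)
    (hqstar : optimal_consumption gamma p p2 b qmax qstar) :
  (pr <= p / (p2 + p) ->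
     optimal_report gamma p p2 b qmax pr qstar
       (pr * p2 / (gamma * (1 - pr)) + b) (pos_part (b - p2 / gamma))) /\
  (p / (p2 + p) <= pr ->
     optimal_report gamma p p2 b qmax pr qstar
       qmax (pos_part (b - p2 / gamma))) /\
  (forall bhat qhat : R,
     0 < pr ->
     optimal_report gamma p p2 b qmax pr qstar bhat qhat ->
     qhat = pos_part (b - p2 / gamma) /\
     (pr < p / (p2 + p) -> bhat = pr * p2 / (gamma * (1 - pr)) + b) /\
     (p / (p2 + p) < pr -> bhat = qmax)).
Proof.
assert (Hpg : 0 < p / gamma) by (apply Rdiv_lt_0_compat; lra).
assert (Hp2 : 0 < p2) by lra.
assert (Hbq : b <= qmax) by lra.
assert (Hpr : 0 <= pr) by lra.
split; [|split].
- intros Hlow.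
  destruct (low_probability_bounds p p2 pr hp Hp2 Hpr Hlow) as [Hpr1 Hs].
  pose proof (low_report_bounds gamma p p2 b pr hgamma Hp2 ltac:(lra) Hs).
  apply optimal_report_of_gain; try assumption; [lra|].
  intros x _; apply report_gain_low_le; try assumption; lra.
- intros Hhigh.
  pose proof (high_probability p p2 pr hp Hp2 Hhigh) as Hs.
  apply optimal_report_of_gain; try assumption; [lra|].
  intros x Hx; apply report_gain_high_le; assumption.
- intros bhat qhat Hpr0 Hopt.
  pose proof (fun x => gain_of_optimal_report gamma p p2 b qmax pr bhat qhat x
    qstar hgamma hp Hp2 hb Hbq Hpr hqstar Hopt) as Hgain.
  pose proof Hopt as [Hf Hmax].
  assert (Hbhat : bhat <= qmax) by (destruct Hf as [Hf _]; cbn in Hf; lra).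
  (* A report below [b] is strictly improved by [b]; this supplies the condition under which a wrong
     [qhat] is strictly worse. *)
  assert (Hbb : b <= bhat).
  { apply Rnot_lt_le; intros Hlt.
    pose proof (report_gain_lt_baseline gamma p p2 b pr bhat Hpr0 Hp2 Hlt).
    specialize (Hgain b ltac:(lra)); lra. }
  split; [|split].
  + destruct (Req_dec qhat (pos_part (b - p2 / gamma))) as [He|Hne]; [exact He|].
    pose proof (expected_profit_lt gamma p p2 b qmax pr bhat qhat qstar
      hgamma hp Hp2 hb Hbq Hpr0 hqstar Hf Hbb Hne).
    pose proof (expected_profit_attained gamma p p2 b qmax pr bhat qstar
      hgamma hp Hp2 hb Hbq Hpr hqstar ltac:(lra)).
    pose proof (Hmax _ (feasible_reduced_report gamma p2 b qmax bhat
      hgamma Hp2 hb ltac:(lra))).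
    lra.
  + intros Hlow.
    destruct (low_probability_bounds p p2 pr hp Hp2 Hpr ltac:(lra))
      as [Hpr1 Hs].
    pose proof (strict_low_probability p p2 pr hp Hp2 Hlow) as Hs'.
    pose proof (low_report_bounds gamma p p2 b pr hgamma Hp2 ltac:(lra) Hs).
    destruct (Req_dec bhat (pr * p2 / (gamma * (1 - pr)) + b)) as [He|Hne];
      [exact He|].
    pose proof (report_gain_low_lt gamma p p2 b pr bhat hgamma Hp2 ltac:(lra)
      Hs' Hne).
    specialize (Hgain (pr * p2 / (gamma * (1 - pr)) + b) ltac:(lra)); lra.
  + intros Hhigh.
    pose proof (strict_high_probability p p2 pr hp Hp2 Hhigh) as Hs.
    destruct (Rlt_le_dec bhat qmax) as [Hlt|Hge]; [|lra].
    pose proof (report_gain_high_lt gamma p p2 b qmax pr bhat hgamma Hp2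
      ltac:(lra) Hbq Hlt Hs).
    specialize (Hgain qmax ltac:(lra)); lra.
Qed.
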